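(* Let $k$ be a field, $\sigma$ an arbitrary index set, and fix a monomial order on the exponent vectors of $k[x_i]_{i\in\sigma}$. Every ideal $I\subseteq k[x_i]_{i\in\sigma}$ admits a unique reduced Gröbner basis.
   Context: Let $\mathcal{M} = (\sigma \to_0 \mathbb{N})$ be the set of finitely supported functions $\sigma\to\mathbb{N}$ (exponent vectors); $\sigma$ may be infinite. A monomial order is a binary relation $\le$ on $\mathcal{M}$ such that (1) $\le$ is a well-order (a linear order with no infinite strictly descending chain), (2) $a\le b$ implies $a+c\le b+c$ for all $a,b,c\in\mathcal{M}$, and (3) $0\le a$ for all $a\in\mathcal{M}$. For a nonzero polynomial $f=\sum_{j\in\mathcal{M}} a_j x^j$, let $\deg(f)=\max\{j\in\mathcal{M} : a_j\ne 0\}$ (maximum with respect to the monomial order), $\mathrm{LC}(f)=a_{\deg(f)}$, $\mathrm{LM}(f)=x^{\deg(f)}$ and $\mathrm{LT}(f)=\mathrm{LC}(f)\,\mathrm{LM}(f)$. For the zero polynomial, $\mathrm{LM}(0)=0$, $\mathrm{LT}(0)=0$, $\mathrm{LC}(0)=0$. A polynomial is monic if its leading coefficient $\mathrm{LC}$ is $1$. Gröbner basis: a subset $G$ (possibly infinite, possibly empty) of an ideal $I$ is a Gröbner basis of $I$ if $\langle \mathrm{LT}(G)\rangle=\langle \mathrm{LT}(I)\rangle$, where $\mathrm{LT}(G)$, $\mathrm{LT}(I)$ are the sets of leading terms of elements of $G$, $I$, and $\langle\cdot\rangle$ denotes the ideal generated. Reduced Gröbner basis: a subset $G\subseteq I$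 is a reduced Gröbner basis of $I$ if (1) $G$ is a Gröbner basis of $I$; (2) every $p\in G$ is monic; (3) for all distinct $p,q\in G$, no monomial appearing in $p$ (with nonzero coefficient) is divisible by $\mathrm{LM}(q)$. *)

(* Defs.v *)
From HB Require Import structures.
From mathcomp Require Import all_boot all_algebra.
From mathcomp Require Import finmap classical_sets.
From mathcomp.multinomials Require Import monalg.

Set Implicit Arguments.
Unset Strict Implicit.
Unset Printing Implicit Defensive.

Import GRing.Theory.

Local Open Scope classical_set_scope.
Local Open Scope ring_scope.

(* {cmonom sigma} is the type of finitely supported functions sigma -> nat,
   written multiplicatively: mone is the zero exponent vector and mmul is
   pointwise addition.  Hence {malg k[{cmonom sigma}]} is k[x_i]_{i in sigma},
   and << m >> is x^m. *)

Record monomial_order (sigma : choiceType) (le : rel {cmonom sigma}) : Prop :=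
  MonomialOrder {
    mo_refl : reflexive le;
    mo_anti : antisymmetric le;
    mo_trans : transitive le;
    mo_total : total le;
    mo_wf : ~ exists u : nat -> {cmonom sigma},
                forall n, le (u n.+1) (u n) && (u n.+1 != u n);
    mo_mul : forall a b c, le a b -> le (mmul a c) (mmul b c);
    mo_ge0 : forall a, le mone a
  }.

Definition omax (sigma : choiceType) (le : rel {cmonom sigma})
    (a b : {cmonom sigma}) : {cmonom sigma} :=
  if le a b then b else a.

(* Starting the iterated maximum at mone is harmless, mone being the least
   element (see ldegP); ldeg le 0 = mone is a junk value. *)
Definition ldeg (k : fieldType) (sigma : choiceType) (le : rel {cmonom sigma})
    (f : {malg k[{cmonom sigma}]}) : {cmonom sigma} :=
  \big[omax le/mone]_(m <- msupp f) m.

Definition lcoef (k : fieldType) (sigma : choiceType) (le : rel {cmonom sigma})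
    (f : {malg k[{cmonom sigma}]}) : k :=
  f@_(ldeg le f).

Definition lmonom (k : fieldType) (sigma : choiceType)
    (le : rel {cmonom sigma}) (f : {malg k[{cmonom sigma}]}) :
    {malg k[{cmonom sigma}]} :=
  if f == 0 then 0 else << ldeg le f >>.

Definition lterm (k : fieldType) (sigma : choiceType)
    (le : rel {cmonom sigma}) (f : {malg k[{cmonom sigma}]}) :
    {malg k[{cmonom sigma}]} :=
  lcoef le f *: lmonom le f.

Lemma ldegP (k : fieldType) (sigma : choiceType) (le : rel {cmonom sigma})
    (f : {malg k[{cmonom sigma}]}) :
  monomial_order le -> f != 0 ->
  ldeg le f \in msupp f /\ forall m, m \in msupp f -> le m (ldeg le f).
Proof.
case=> lexx leanti letr letot _ _ le0 f0.
have mx (s : seq {cmonom sigma}) m :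
    m \in s -> le m (\big[omax le/mone]_(i <- s) i).
  elim: s => // a s IH; rewrite big_cons inE /omax => /predU1P[->|/IH {}IH].
    by case: ifP => //; rewrite lexx.
  case: ifP => // /negbT nle; apply: letr IH _.
  by have := letot a (\big[omax le/mone]_(i <- s) i); rewrite (negPf nle).
have sE (s : seq {cmonom sigma}) :
    s != [::] -> \big[omax le/mone]_(i <- s) i \in s.
  elim: s => // a s IH _; rewrite big_cons /omax.
  have [->|/IH {}IH] := eqVneq s [::].
    rewrite big_nil; case: ifP => h; last by rewrite mem_head.
    by rewrite mem_seq1 (leanti a mone) // h le0.
  by case: ifP => _; rewrite inE ?eqxx // IH orbT.
split; last by move=> m; apply: mx.
apply: sE; apply: contraNneq f0 => s0.
rewrite -msupp_eq0; apply/eqP/fsetP => m.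
by rewrite -[m \in msupp f]/(m \in (msupp f : seq _)) s0.
Qed.

(* ring_quotient's idealr_closed is not used: it requires 1 to be outside. *)
Definition is_ideal (R : comNzRingType) (J : set R) : Prop :=
  [/\ J 0, (forall f g, J f -> J g -> J (f + g))
    & (forall h f, J f -> J (h * f))].

Definition ideal_gen (R : comNzRingType) (A : set R) : set R :=
  smallest (@is_ideal R) A.

Definition divides (R : comNzRingType) (f g : R) : Prop :=
  exists h, g = h * f.

Definition groebner_basis (k : fieldType) (sigma : choiceType)
    (le : rel {cmonom sigma}) (J G : set {malg k[{cmonom sigma}]}) : Prop :=
  G `<=` J /\ ideal_gen (lterm le @` G) = ideal_gen (lterm le @` J).

Definition reduced_groebner_basis (k : fieldType) (sigma : choiceType)
    (le : rel {cmonom sigma}) (J G : set {malg k[{cmonom sigma}]}) : Prop :=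
  [/\ groebner_basis le J G,
      (forall p, G p -> lcoef le p = 1)
    & (forall p q, G p -> G q -> p <> q ->
       forall m, m \in msupp p ->
       ~ divides (lmonom le q) (<< m >> : {malg k[{cmonom sigma}]}))].

(* Main.v *)
(** Let E be the set of leading exponents of the nonzero elements of I; it is
    closed under multiples.  Reducing modulo I along the well-order, every
    monomial is congruent modulo I to a polynomial without exponents in E and
    without larger exponents.  Applied to the divisibility-minimal elements m
    of E this gives elements x^m - r_m of I, and these form the reduced Groebner
    basis.  Two elements of I with the same leading exponent, leading
    coefficient 1 and no other exponent in E coincide, since the leading
    exponent of their difference would lie in E; this gives uniqueness. *)

Require Import Defs.
From mathcomp Require Import all_boot all_algebra.
From mathcomp Require Import finmap classical_sets boolp.
From mathcomp.multinomials Require Import monalg.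

Set Implicit Arguments.
Unset Strict Implicit.
Unset Printing Implicit Defensive.

Import GRing.Theory.

Local Open Scope classical_set_scope.
Local Open Scope ring_scope.

(** * Divisibility of exponent vectors *)

Section CMonom.
Context (sigma : choiceType).
Implicit Types a b c m : {cmonom sigma}.

Definition mdvd a b : Prop := exists c, b = mmul c a.

Lemma mdvd_refl a : mdvd a a.
Proof. by exists mone; rewrite mul1m. Qed.

Lemma mdvd_trans a b c : mdvd a b -> mdvd b c -> mdvd a c.
Proof. by move=> [u ->] [v ->]; exists (mmul v u); rewrite mulmA. Qed.

Lemma cmonom_mulI c : injective (mmul c).
Proof.
move=> a b /eqP/cmP eab; apply/eqP/cmP => i.
by have := eab i; rewrite !cmM => /addnI.
Qed.

Lemma mcoeff_mulU (R : nzRingType) (f : {malg R[{cmonom sigma}]}) c m :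
  (<< c >> * f)@_(mmul c m) = f@_m.
Proof.
rewrite malgM_def fgmulUg raddf_sum /=.
under eq_bigr => i _ do rewrite mul1r mcoeffU (inj_eq (@cmonom_mulI c)).
rewrite [in RHS](monalgE f) raddf_sum /=.
by apply: eq_bigr => i _; rewrite mcoeffU.
Qed.

Lemma scale_malgU (R : nzRingType) (c : R) m :
  c *: << m >> = << c *g m >> :> {malg R[{cmonom sigma}]}.
Proof. by rewrite -mul_malgC malgM_def fgmulUU mul1m mulr1. Qed.

Lemma divides_mdvd (R : comNzRingType) a b :
  divides (<< a >> : {malg R[{cmonom sigma}]}) << b >> -> mdvd a b.
Proof.
move=> [h eb].
have: b \in msupp (<< b >> : {malg R[{cmonom sigma}]}) by rewrite msuppU1 in_fset1.
rewrite {1}eb => /msuppM_le[c [d [_]]]; rewrite msuppU1 in_fset1 => /eqP -> ->.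
by exists c.
Qed.

End CMonom.

(** * Descent along the monomial order *)

Section MonomialOrder.
Context (sigma : choiceType) (le : rel {cmonom sigma}).
Context (hle : monomial_order le).
Implicit Types a b m : {cmonom sigma}.

(** If the induction failed, every counterexample would have a strictly smaller one; choosing one
    each time and iterating gives a descending sequence that [mo_wf] forbids. *)
Lemma mo_ind (P : {cmonom sigma} -> Prop) :
  (forall m, (forall m', le m' m -> m' != m -> P m') -> P m) -> forall m, P m.
Proof.
move=> IH m0; apply: contrapT => nPm0.
have step (x : {m | ~ P m}) :
    exists y : {m | ~ P m}, le (sval y) (sval x) && (sval y != sval x).
  apply: contrapT => nex; apply: (svalP x); apply: IH => m' lem' nem'.
  apply: contrapT => nPm'; apply: nex.
  by exists (exist _ m' nPm'); rewrite /= lem' nem'.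
have [next nextP] := choice step.
apply: (mo_wf hle); exists (fun n => sval (iter n next (exist _ m0 nPm0))).
by move=> n; apply: nextP.
Qed.

Lemma mdvd_le a b : mdvd a b -> le a b.
Proof.
by move=> [c ->]; have := mo_mul hle a (mo_ge0 hle c); rewrite mul1m.
Qed.

Lemma mdvd_anti a b : mdvd a b -> mdvd b a -> a = b.
Proof.
by move=> /mdvd_le ab /mdvd_le ba; apply: (mo_anti hle); rewrite ab ba.
Qed.

(** Proper divisors are strictly smaller for [le], so passing to proper divisors inside [E] must
    stop, even when [sigma] is infinite. *)
Lemma mdvd_minimal (E : set {cmonom sigma}) m :
  E m -> exists2 a, E a /\ mdvd a m & forall d, E d -> mdvd d a -> d = a.
Proof.
elim/mo_ind: m => m IH Em.
have [[d [Ed dm nem]]|nex] := pselect (exists d, [/\ E d, mdvd d m & d != m]).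
  have [a [Ea ad] amin] := IH d (mdvd_le dm) nem Ed.
  by exists a => //; split=> //; apply: mdvd_trans ad dm.
exists m; first by split=> //; apply: mdvd_refl.
move=> d Ed dm; have [//|nem] := eqVneq d m.
by case: nex; exists d.
Qed.

(** * Leading exponents of polynomials *)

Section Field.
Context (k : fieldType).
Local Notation poly := {malg k[{cmonom sigma}]}.
Implicit Types (f g h p r : poly) (J G : set poly).

Lemma ldeg_supp f : f != 0 -> ldeg le f \in msupp f.
Proof. by move=> /(ldegP hle)[]. Qed.

Lemma msupp_neq0 f m : m \in msupp f -> f != 0.
Proof. by apply: contraTneq => ->; rewrite msupp0 in_fset0. Qed.

Lemma ldeg_ub f m : m \in msupp f -> le m (ldeg le f).
Proof. by move=> mf; apply: (ldegP hle (msupp_neq0 mf)).2. Qed.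

Lemma ldeg_eq f m :
  m \in msupp f -> (forall m', m' \in msupp f -> le m' m) -> ldeg le f = m.
Proof.
move=> mf ub; apply: (mo_anti hle).
by rewrite ldeg_ub // ub // ldeg_supp // (msupp_neq0 mf).
Qed.

Lemma lcoef_neq0 f : f != 0 -> lcoef le f != 0.
Proof. by move=> f0; rewrite mcoeff_neq0 ldeg_supp. Qed.

Lemma lcoef1_neq0 f : lcoef le f = 1 -> f != 0.
Proof. by apply: contra_eq_neq => ->; rewrite /lcoef mcoeff0 eq_sym oner_eq0. Qed.

Lemma ltermE f : lterm le f = << lcoef le f *g ldeg le f >>.
Proof.
rewrite /lterm /lmonom; have [->|f0] := eqVneq f 0.
  by rewrite scaler0 /lcoef mcoeff0 monalgU0.
exact: scale_malgU.
Qed.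

Lemma ldegMU f m : f != 0 ->
  << m >> * f != 0 /\ ldeg le (<< m >> * f) = mmul m (ldeg le f).
Proof.
move=> f0; have ms : mmul m (ldeg le f) \in msupp (<< m >> * f).
  by rewrite -mcoeff_neq0 mcoeff_mulU mcoeff_neq0 ldeg_supp.
split; first exact: msupp_neq0 ms.
apply: ldeg_eq => // m' /msuppM_le[a [b []]].
rewrite msuppU1 in_fset1 => /eqP -> bf ->; rewrite !(mulmC m).
exact: (mo_mul hle) (ldeg_ub bf).
Qed.

Definition lead_exp J : set {cmonom sigma} :=
  [set m | exists f, [/\ J f, f != 0 & ldeg le f = m]].

(** The candidate basis, described without choosing normal forms, so that any reduced basis can be
    compared with it elementwise. *)
Definition reduced_elts J : set poly :=
  [set g | [/\ J g, lcoef le g = 1,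
               forall d, lead_exp J d -> mdvd d (ldeg le g) -> d = ldeg le g
             & forall m, m \in msupp g -> lead_exp J m -> m = ldeg le g]].

(** * Normal forms modulo an ideal *)

Section Ideal.
Context (J : set poly) (hJ : is_ideal J).

Lemma ideal0 : J 0. Proof. by case: hJ. Qed.
Lemma idealD f g : J f -> J g -> J (f + g). Proof. by case: hJ => _ + _; apply. Qed.
Lemma idealM h f : J f -> J (h * f). Proof. by case: hJ => _ _; apply. Qed.
Lemma idealB f g : J f -> J g -> J (f - g).
Proof. by move=> Jf Jg; apply: idealD => //; rewrite -mulN1r; apply: idealM. Qed.
Lemma idealZ (c : k) f : J f -> J (c *: f).
Proof. by move=> Jf; rewrite -mul_malgC; apply: idealM. Qed.

Lemma lead_exp_mdvd a b : mdvd a b -> lead_exp J a -> lead_exp J b.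
Proof.
move=> [c ->] [f [Jf f0 <-]]; have [cf0 dcf] := ldegMU c f0.
by exists (<< c >> * f); split=> //; apply: idealM.
Qed.

Lemma lead_exp_monic m : lead_exp J m ->
  exists f, [/\ J f, f@_m = 1 & forall m', m' \in msupp f -> le m' m].
Proof.
move=> [f [Jf f0 <-]]; exists ((lcoef le f)^-1 *: f); split.
- exact: idealZ.
- by rewrite mcoeffZ mulVf // lcoef_neq0.
- by move=> m' /(fsubsetP (msuppZ_le _ _)) /ldeg_ub.
Qed.

Lemma lead_exp_eq0 f : J f -> (forall m, m \in msupp f -> ~ lead_exp J m) -> f = 0.
Proof.
move=> Jf nE; apply/eqP/negPn/negP => f0.
by apply: (nE _ (ldeg_supp f0)); exists f.
Qed.

Lemma normal_form m : exists r, J (<< m >> - r) /\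
  forall m', m' \in msupp r -> le m' m /\ ~ lead_exp J m'.
Proof.
elim/mo_ind: m => m IH.
have [Em|nEm] := pselect (lead_exp J m); last first.
  exists << m >>; split; first by rewrite subrr; apply: ideal0.
  by move=> m'; rewrite msuppU1 in_fset1 => /eqP ->; split=> //; apply: (mo_refl hle).
have [f [Jf fm fle]] := lead_exp_monic Em.
(* The coefficient of [m] cancels, so all exponents of [u] are strictly below [m] and the induction
   hypothesis applies to each of them. *)
pose u : poly := << m >> - f.
have mE : << m >> = u + f by rewrite subrK.
have /choice[nf nfP] : forall m', exists r, m' \in msupp u ->
    J (<< m' >> - r) /\
    forall m'', m'' \in msupp r -> le m'' m /\ ~ lead_exp J m''.
  move=> m'; have [m's|] := boolP (m' \in _); last by exists 0.
  have nem : m' != m.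
    apply: contraTneq m's => ->.
    by rewrite -mcoeff_neq0 mcoeffB mcoeffUU fm subrr eqxx.
  have lem : le m' m.
    have := fsubsetP (msuppB_le _ _) _ m's.
    by rewrite in_fsetU msuppU1 in_fset1 (negPf nem) => /fle.
  have [r [Jr rP]] := IH _ lem nem; exists r => _; split=> // m'' /rP[le' nE].
  by split=> //; apply: (mo_trans hle) lem.
exists (\sum_(i <- msupp u) u@_i *: nf i); split.
  (* Modulo [f] in [J], what remains is the combination of the differences [<< i >> - nf i] with the
     coefficients of [u]. *)
  rewrite mE addrAC; apply: idealD => //.
  rewrite {1}[u]monalgE -sumrB big_seq.
  apply: big_ind => [|x y|i iu]; [exact: ideal0|exact: idealD|].
  by rewrite -scale_malgU -scalerBr; apply: idealZ; case: (nfP i iu).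
rewrite big_seq; apply: (big_ind (fun r : poly => forall m', m' \in msupp r ->
    le m' m /\ ~ lead_exp J m')) => [m'|x y xP yP m'|i iu m'].
- by rewrite msupp0 in_fset0.
- by move=> /(fsubsetP (msuppD_le _ _)); rewrite in_fsetU => /orP[/xP|/yP].
- by move=> /(fsubsetP (msuppZ_le _ _)); apply: (nfP i iu).2.
Qed.

Lemma reduced_elts_exists m : lead_exp J m ->
    (forall d, lead_exp J d -> mdvd d m -> d = m) ->
  exists2 g, reduced_elts J g & ldeg le g = m.
Proof.
move=> Em mmin; have [r [Jr rP]] := normal_form m.
(* Exponents of [r] avoid [lead_exp J], which contains [m]. *)
have rm : r@_m = 0.
  by apply/eqP; rewrite mcoeff_eq0; apply/negP => /rP[].
have gm : (<< m >> - r)@_m = 1 by rewrite mcoeffB mcoeffUU rm subr0.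
have suppP m' : m' \in msupp (<< m >> - r) -> m' = m \/ m' \in msupp r.
  move=> /(fsubsetP (msuppB_le _ _)); rewrite in_fsetU msuppU1 in_fset1.
  by move=> /orP[/eqP|]; [left|right].
have dg : ldeg le (<< m >> - r) = m.
  apply: ldeg_eq; first by rewrite -mcoeff_neq0 gm oner_eq0.
  by move=> m' /suppP[->|/rP[//]]; apply: (mo_refl hle).
exists (<< m >> - r) => //; split; rewrite /lcoef ?dg //.
by move=> m' /suppP[//|/rP[]].
Qed.

Lemma reduced_elts_inj g h :
  reduced_elts J g -> reduced_elts J h -> ldeg le g = ldeg le h -> g = h.
Proof.
move=> [Jg g1 _ gP] [Jh h1 _ hP] egh; apply/eqP; rewrite -subr_eq0; apply/eqP.
apply: lead_exp_eq0; first exact: idealB.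
move=> m ms Em; have em : m = ldeg le g.
  move: (fsubsetP (msuppB_le _ _) _ ms); rewrite in_fsetU => /orP[/gP|/hP->//].
  exact.
move: ms; rewrite -mcoeff_neq0 mcoeffB em [g@__]g1 egh [h@__]h1.
by rewrite subrr eqxx.
Qed.

(** * Gröbner bases in terms of divisibility of leading exponents *)

Lemma groebner_mdvd G m : groebner_basis le J G -> lead_exp J m ->
  exists g, [/\ G g, g != 0 & mdvd (ldeg le g) m].
Proof.
move=> [_ eGJ] [f [Jf f0 dfm]].
have : ideal_gen (lterm le @` G) (lterm le f).
  by rewrite eGJ; apply: sub_gen_smallest; exists f.
(* These polynomials form an ideal containing the leading terms of [G], hence also the leading term
   of [f]. *)
have divI : is_ideal [set p : poly | forall m, m \in msupp p ->
    exists g, [/\ G g, g != 0 & mdvd (ldeg le g) m]].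
  split=> [m'|p q pP qP m'|h p pP m'].
  - by rewrite msupp0 in_fset0.
  - by move=> /(fsubsetP (msuppD_le _ _)); rewrite in_fsetU => /orP[/pP|/qP].
  - move=> /msuppM_le[a [b [_ /pP[g [Gg g0 gb]] ->]]]; exists g; split=> //.
    by apply: mdvd_trans gb _; exists a.
move=> /(_ _ (conj divI _)); apply.
  move=> _ [g Gg <-] m'; rewrite ltermE => m's; exists g; split=> //.
    (* If [0] is in [G], its junk leading exponent [mone] would divide everything; but its leading
       term has empty support. *)
    by apply: contraTneq m's => ->; rewrite /lcoef mcoeff0 monalgU0 msupp0 in_fset0.
  move: m's => /(fsubsetP msuppU_le); rewrite in_fset1 => /eqP ->.
  exact: mdvd_refl.
by rewrite ltermE msuppU (negPf (lcoef_neq0 f0)) dfm in_fset1.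
Qed.

Lemma mdvd_groebner G : G `<=` J ->
    (forall g, G g -> lcoef le g = 1) ->
    (forall m, lead_exp J m -> exists2 g, G g & mdvd (ldeg le g) m) ->
  groebner_basis le J G.
Proof.
move=> GJ G1 Gdvd; split=> //; apply/seteqP; split=> p pG A [idA sA].
  by apply: pG; split=> // _ [g Gg <-]; apply: sA; exists g => //; apply: GJ.
apply: pG; split=> // _ [f Jf <-]; rewrite ltermE.
have [A0 _ AM] := idA.
have [->|f0] := eqVneq f 0; first by rewrite /lcoef mcoeff0 monalgU0.
have [|g Gg [c ->]] := Gdvd (ldeg le f); first by exists f.
have -> : << lcoef le f *g mmul c (ldeg le g) >> =
    << lcoef le f *g c >> * lterm le g :> poly.
  by rewrite ltermE (G1 g) // malgM_def fgmulUU mulr1.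
by apply: AM; apply: sA; exists g.
Qed.

Lemma reduced_elts_reduced_groebner :
  reduced_groebner_basis le J (reduced_elts J).
Proof.
split; last 1 first.
- move=> p q pG qG npq m mp; have [Jq q1 _ _] := qG; have q0 := lcoef1_neq0 q1.
  rewrite /lmonom (negPf q0) => /divides_mdvd qm.
  have Eq : lead_exp J (ldeg le q) by exists q.
  have [_ _ pmin pP] := pG.
  (* As a multiple of [ldeg le q], [m] lies in [lead_exp J], so it is the leading exponent of [p];
     minimality then identifies it with [ldeg le q]. *)
  apply: npq; apply: reduced_elts_inj => //; apply/esym/pmin => //.
  by rewrite -(pP m mp) //; apply: lead_exp_mdvd Eq.
- apply: mdvd_groebner => [g []|g []|m Em] //.
  have [a [Ea am] amin] := mdvd_minimal Em.
  have [g gG dg] := reduced_elts_exists Ea amin.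
  by exists g => //; rewrite dg.
- by move=> p [].
Qed.

(** By reducedness, an element of [G] whose leading exponent divides some exponent of [g] must be
    [g] itself. By the Gröbner property, every exponent in [lead_exp J] has such a divisor. *)
Lemma reduced_groebner_sub G :
  reduced_groebner_basis le J G -> G `<=` reduced_elts J.
Proof.
move=> [gG G1 Gred] g Gg; have GJ := gG.1.
have dvd_g h m : G h -> m \in msupp g -> mdvd (ldeg le h) m -> h = g.
  move=> Gh mg [c em]; apply: contrapT => nhg.
  apply: (Gred g h Gg Gh (fun e => nhg (esym e)) m mg).
  rewrite /lmonom (negPf (lcoef1_neq0 (G1 h Gh))); exists << c >>.
  by rewrite malgM_def fgmulUU mulr1 em.
split; [exact: GJ|exact: G1| |].
- move=> d Ed dg; have [h [Gh _ hd]] := groebner_mdvd gG Ed.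
  apply: mdvd_anti => //; rewrite -(dvd_g h (ldeg le g)) //.
    by rewrite ldeg_supp // lcoef1_neq0 // G1.
  exact: mdvd_trans hd dg.
- move=> m mg Em; have [h [Gh _ hm]] := groebner_mdvd gG Em.
  have hg := dvd_g h m Gh mg hm; rewrite {}hg in hm.
  by apply: (mo_anti hle); rewrite ldeg_ub // mdvd_le.
Qed.

(** For the remaining inclusion, some [h] in [G] has a leading exponent dividing that of [g];
    minimality makes them equal, and [h] is itself in [reduced_elts J]. *)
Lemma reduced_groebner_unique G :
  reduced_groebner_basis le J G -> reduced_elts J = G.
Proof.
move=> GG; apply/seteqP; split; last exact: reduced_groebner_sub.
move=> g gG; have [Jg g1 gmin _] := gG; have [gbG G1 _] := GG.
have Eg : lead_exp J (ldeg le g) by exists g; rewrite lcoef1_neq0.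
have [h [Gh h0 hg]] := groebner_mdvd gbG Eg.
suff -> : g = h by [].
apply: reduced_elts_inj gG (reduced_groebner_sub GG Gh) _.
by apply/esym/gmin => //; exists h; split=> //; apply: gbG.1.
Qed.

End Ideal.
End Field.
End MonomialOrder.

Theorem theorem9 (k : fieldType) (sigma : choiceType)
    (le : rel {cmonom sigma}) (hle : monomial_order le)
    (I : set {malg k[{cmonom sigma}]}) (hI : is_ideal I) :
  exists! G : set {malg k[{cmonom sigma}]}, reduced_groebner_basis le I G.
Proof.
exists (reduced_elts le I); split; first exact: reduced_elts_reduced_groebner.
exact: reduced_groebner_unique.
Qed.
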